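(* Let $d$ be a natural number and $M\ge 0$. Suppose that a Boolean algebra $\mathfrak A$ is generated by a set $\Gamma\subseteq\mathfrak A$ such that every nonempty finite set $F\subseteq\Gamma$ satisfies $|\mathrm{Atom}(F)|\le M|F|^d$. Then $\text{free-dim}(K_{\mathfrak A})\le d$.
   Context: For a finite subset $F$ of a Boolean algebra $\mathfrak A$, $\mathrm{Atom}(F)$ is the set of atoms of the Boolean subalgebra of $\mathfrak A$ generated by $F$. $K_{\mathfrak A}$ denotes the Stone space of all ultrafilters on $\mathfrak A$. For a compact space $K$, $\mathrm{FCC}(K)$ denotes the family of all finite covers of $K$ by closed subsets. For finite covers $\mathcal C_1,\mathcal C_2$ of $K$ write $\mathcal C_1\prec\mathcal C_2$ ($\mathcal C_1$ refines $\mathcal C_2$) if every $C_1\in\mathcal C_1$ is contained in some $C_2\in\mathcal C_2$. A family $\mathfrak C\subseteq \mathrm{FCC}(K)$ is topologically cofinal if for every open cover $\mathcal U$ of $K$ there is $\mathcal C\in\mathfrak C$ with $\mathcal C\prec\mathcal U$ (every member of $\mathcal C$ is contained in a member of $\mathcal U$). For $d\in\mathbb N=\{0,1,2,\dots\}$, write $\text{free-dim}(K)\le d$ if there are a topologically cofinal family $\mathfrak C\subseteq\mathrm{FCC}(K)$, a constant $M>0$ and a function $\chi:\mathfrak C\to\mathbb N$ such that for every $k\ge 1$, any $\mathcal C_1,\dots,\mathcal C_k\in\mathfrak C$ have a joint refinement $\mathcal C\in\mathrm{FCC}(K)$ (i.e. $\mathcal C\prec\mathcal C_i$ for all $i\le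 k$) with $|\mathcal C|\le M\big(\chi(\mathcal C_1)+\dots+\chi(\mathcal C_k)\big)^d$ (with $0^0=1$). *)

(* Defs.v *)
From HB Require Import structures.
From mathcomp Require Import all_boot all_order all_algebra finmap.
From mathcomp Require Import all_classical all_reals topology.

Set Implicit Arguments.
Unset Strict Implicit.
Unset Printing Implicit Defensive.

Import Order.TTheory GRing.Theory Num.Theory.
Local Open Scope classical_set_scope.
Local Open Scope ring_scope.

(* [S] is finite and |S| <= x. *)
Definition card_le_real (R : realType) (T : Type) (S : set T) (x : R) : Prop :=
  exists2 n : nat, (S #= `I_n)%card & n%:R <= x.

Section BooleanAlgebra.
Local Open Scope order_scope.
Variables (disp : Order.disp_t) (A : ctbDistrLatticeType disp).

Definition boolean_subalgebra (B : set A) : Prop :=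
  [/\ B \bot, B \top,
      (forall a b, B a -> B b -> B (a `&` b)),
      (forall a b, B a -> B b -> B (a `|` b)) &
      (forall a, B a -> B (~` a))].

Definition generated_subalgebra (F : set A) : set A :=
  smallest boolean_subalgebra F.

Definition Atom (F : set A) : set A :=
  [set a | [/\ generated_subalgebra F a, a <> \bot &
     forall b, generated_subalgebra F b -> b <= a -> b = \bot \/ b = a]].

Definition proper_filter (U : set A) : Prop :=
  [/\ U \top, ~ U \bot,
      (forall a b, U a -> U b -> U (a `&` b)) &
      (forall a b, U a -> a <= b -> U b)].

Definition ultrafilter (U : set A) : Prop :=
  proper_filter U /\
  forall V : set A, proper_filter V -> (U `<=` V)%classic -> V = U.

Record stone_space : Type := StoneSpace {
  stone_set : set A;
  stone_setP : ultrafilter stone_set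
}.

HB.instance Definition _ := gen_eqMixin stone_space.
HB.instance Definition _ := gen_choiceMixin stone_space.

Definition stone_basic (a : A) : set stone_space := [set U | stone_set U a].

Lemma stone_basic_cover :
  (\bigcup_(X in range stone_basic) X = setT)%classic.
Proof.
apply/seteqP; split => // U _; exists (stone_basic \top); first by exists \top.
by case: U => U [[? ? ? ?] ?].
Qed.

Lemma stone_basic_join (X Y : set stone_space) (U : stone_space) :
  range stone_basic X -> range stone_basic Y -> X U -> Y U ->
  exists Z, [/\ range stone_basic Z, Z U & (Z `<=` X `&` Y)%classic].
Proof.
move=> [a _ <-] [b _ <-] Ua Ub; exists (stone_basic (a `&` b)); split.
- by exists (a `&` b).
- by case: U Ua Ub => U [[? ? UI ?] ?]; exact: UI.
- move=> [V [[V1 V0 VI Vup] Vmax]] /= Vab; split; apply: (Vup _ _ Vab).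
  + exact: leIl.
  + exact: leIr.
Qed.

(* The topology with base the sets { U | a \in U }, for a in the algebra. *)
HB.instance Definition _ :=
  isBaseTopological.Build stone_space stone_basic_cover stone_basic_join.

End BooleanAlgebra.

Section FreeDimension.

Definition refines (T : Type) (C1 C2 : set (set T)) : Prop :=
  forall X, C1 X -> exists2 Y, C2 Y & X `<=` Y.

Variable K : topologicalType.

Definition FCC : set (set (set K)) :=
  [set C | [/\ finite_set C, (forall X, C X -> closed X) &
               \bigcup_(X in C) X = setT]].

Definition open_cover (U : set (set K)) : Prop :=
  (forall X, U X -> open X) /\ \bigcup_(X in U) X = setT.

Definition topologically_cofinal (CC : set (set (set K))) : Prop :=
  forall U, open_cover U -> exists2 C, CC C & refines C U.

(* free-dim(K) <= d; only the values of [chi] on members of [CC] matter.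
   Note that 0 ^+ 0 = 1 in a ring. *)
Definition free_dim_le (R : realType) (d : nat) : Prop :=
  exists (CC : set (set (set K))) (M : R) (chi : set (set K) -> nat),
    [/\ CC `<=` FCC, topologically_cofinal CC, 0 < M &
      forall (k : nat) (Cs : 'I_k -> set (set K)), (1 <= k)%N ->
        (forall i, CC (Cs i)) ->
        exists C, [/\ FCC C, (forall i, refines C (Cs i)) &
          card_le_real C (M * (\sum_(i < k) chi (Cs i))%N%:R ^+ d)]].

End FreeDimension.

(* Main.v *)
Require Import Defs.
From HB Require Import structures.
From mathcomp Require Import all_boot all_order all_algebra finmap.
From mathcomp Require Import all_classical all_reals topology.
Import Order.TTheory Order.CTheory GRing.Theory Num.Theory.
Set Implicit Arguments.
Unset Strict Implicit.
Unset Printing Implicit Defensive.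

Local Open Scope classical_set_scope.
Local Open Scope ring_scope.

(** For a finite [F] included in [Gamma], the clopen sets given by the atoms of
    the subalgebra generated by [F] form a finite closed cover [atom_cover F]
    of the Stone space.  The family of all these covers witnesses the dimension
    bound, with [chi (atom_cover F) = |F| + 1].

    The bound comes from taking unions: enlarging [F] refines [atom_cover F]
    ([refines_atom_cover]), so covers given by [F_1, ..., F_k] are jointly
    refined by the cover given by their union, a set of at most
    [|F_1| + ... + |F_k|] elements of [Gamma], and the number of atoms over it is
    bounded by hypothesis.
    The summand [1] in [chi] and the passage from [M] to [M + 1] absorb the empty
    set, which generates a subalgebra with at most one atom; allowing it makes
    the argument uniform even when [Gamma] is empty.

    Cofinality ([atom_covers_cofinal]) is the compactness of the Stone space
    together with the fact that each element of the algebra already lies in the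
    subalgebra generated by a finite part of [Gamma].  Both are handled at once
    by a prime ideal argument: the elements [a] for which some finite [F] cuts
    [a] into atoms subordinate to a given open cover form an ideal
    ([subordinate]); a point of the space avoiding this ideal would have a
    basic neighbourhood inside a member of the cover, which lies in the ideal.

    Everything on atoms rests on one fact ([filter_atom]): a proper filter
    that decides each element of [F] contains an atom of the subalgebra
    generated by [F], namely the meet of the decisions. *)

(** * Finitely generated subalgebras and their atoms *)

Section Subalgebra.
Local Open Scope order_scope.
Variables (disp : Order.disp_t) (A : ctbDistrLatticeType disp).
Implicit Types (F G : set A) (a b c : A) (U V : set A).

Lemma generated_subalgebraP F : boolean_subalgebra (generated_subalgebra F).
Proof.
split.
- by move=> B [[]].
- by move=> B [[]].
- move=> a b aF bF B BF; have [[_ _ BI _ _] _] := BF.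
  exact: BI (aF B BF) (bF B BF).
- move=> a b aF bF B BF; have [[_ _ _ BU _] _] := BF.
  exact: BU (aF B BF) (bF B BF).
- move=> a aF B BF; have [[_ _ _ _ BC] _] := BF.
  exact: BC (aF B BF).
Qed.

Lemma generated_subalgebraS F G :
  (F `<=` G)%classic -> (generated_subalgebra F `<=` generated_subalgebra G)%classic.
Proof. exact: sub_smallest2r (generated_subalgebraP G). Qed.

(** Deciding [a] as a condition on [b] defines a Boolean subalgebra, so it
    suffices to decide the generators. *)
Lemma generated_subalgebra_decided F a b :
  (forall f, F f -> a <= f \/ a <= ~` f) ->
  generated_subalgebra F b -> a <= b \/ a <= ~` b.
Proof.
move=> aF; suff: (generated_subalgebra F `<=` [set b | a <= b \/ a <= (~` b)%O])%classic.
  by apply.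
apply: smallest_sub => //; split => /=.
- by right; rewrite compl0 lex1.
- by left; rewrite lex1.
- move=> x y [ax|ax] [ay|ay]; try by (right; rewrite complI lexU2 // ?ax ?ay ?orbT).
  by left; rewrite lexI ax ay.
- move=> x y [ax|ax] [ay|ay]; try by (left; rewrite lexU2 // ?ax ?ay ?orbT).
  by right; rewrite complU lexI ax ay.
- by move=> x [ax|ax]; [right; rewrite complK|left].
Qed.

Lemma atom_decides F a b :
  Atom F a -> generated_subalgebra F b -> a <= b \/ a <= ~` b.
Proof.
move=> [aF a0 amin] bF; have [_ _ FI _ _] := generated_subalgebraP F.
have [/eqP|<-] := amin _ (FI _ _ aF bF) (leIl a b); last by left; exact: leIr.
by rewrite disj_leC; right.
Qed.

Lemma le_compl_self a b : a <= b -> a <= ~` b -> a = \bot.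
Proof. by move=> ab aNb; apply/eqP; rewrite -lex0 -(meetxC b) lexI ab. Qed.

(** The atom is the meet of the decisions of [U] on the elements of [F]. *)
Lemma filter_atom (F : {fset A}) U :
  proper_filter U -> (forall f, f \in F -> U f \/ U (~` f)) ->
  exists2 a, Atom [set` F] a & U a.
Proof.
move=> [U1 U0 UI _] UF.
have [G0 G1 GI _ GC] := generated_subalgebraP [set` F].
pose t f := if `[< U f >] then f else ~` f.
pose a := \meet_(f <- enum_fset F) t f.
have aF f : f \in F -> a <= f \/ a <= ~` f.
  move=> fF; have : a <= t f by apply: meets_inf_seq.
  by rewrite /t; case: ifP => _; [left|right].
have Ua : U a.
  rewrite /a big_seq; apply: (big_ind U) => // f fF; rewrite /t.
  by case: asboolP => // nUf; have [] := UF _ fF.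
have Ga : generated_subalgebra [set` F] a.
  rewrite /a big_seq; apply: (big_ind (generated_subalgebra [set` F])) => // f fF.
  have Gf : generated_subalgebra [set` F] f by apply: sub_gen_smallest.
  by rewrite /t; case: ifP => // _; exact: GC.
exists a => //; split => //; first by move=> a0; apply: U0; rewrite -a0.
move=> b Gb ba; have [ab|aNb] := generated_subalgebra_decided aF Gb.
  by right; apply/le_anti; rewrite ba ab.
by left; exact: le_compl_self (lexx b) (le_trans ba aNb).
Qed.

Lemma principal_proper_filter a : a <> \bot -> proper_filter [set b | a <= b].
Proof.
move=> a0; split => /=.
- exact: lex1.
- by rewrite lex0 => /eqP.
- by move=> x y ax ay; rewrite lexI ax ay.
- by move=> x y; exact: le_trans.
Qed.

(** An atom over the larger set decides each element of the smaller one, so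
    its principal filter contains an atom over the smaller set. *)
Lemma atom_le_atom (F G : {fset A}) b :
  ([set` F] `<=` [set` G])%classic -> Atom [set` G] b ->
  exists2 a, Atom [set` F] a & b <= a.
Proof.
move=> FG bG; have [_ b0 _] := bG.
apply: filter_atom (principal_proper_filter b0) _ => f fF.
by apply: atom_decides bG _; apply: sub_gen_smallest; exact: FG.
Qed.

Lemma atom_set0 : (Atom [set` (fset0 : {fset A})] `<=` [set \top])%classic.
Proof.
move=> a [aF a0 _] /=.
have [//|a1|a1] := @generated_subalgebra_decided [set` (fset0 : {fset A})] \top a _ aF.
  by apply/le_anti; rewrite a1 lex1.
by case: a0; apply: le_compl_self (lexx a) (le_trans (lex1 a) a1).
Qed.

(** The subalgebras generated by the finite parts of [Gamma] are directed, so
    their union is a subalgebra. *)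
Lemma generated_subalgebra_finite (Gamma : set A) a :
  generated_subalgebra Gamma a ->
  exists2 F : {fset A}, ([set` F] `<=` Gamma)%classic & generated_subalgebra [set` F] a.
Proof.
pose S := [set a | exists2 F : {fset A},
  ([set` F] `<=` Gamma)%classic & generated_subalgebra [set` F] a].
suff: (generated_subalgebra Gamma `<=` S)%classic by apply.
have SU a1 a2 op : S a1 -> S a2 ->
    (forall F, generated_subalgebra F a1 -> generated_subalgebra F a2 ->
       generated_subalgebra F (op a1 a2)) -> S (op a1 a2).
  move=> [F1 F1G a1F] [F2 F2G a2F] Fop.
  exists (F1 `|` F2)%fset.
    by move=> x /= /fsetUP[]; [exact: F1G|exact: F2G].
  apply: Fop.
    by apply: generated_subalgebraS a1F => x /= xF; rewrite in_fsetU xF.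
  by apply: generated_subalgebraS a2F => x /= xF; rewrite in_fsetU xF orbT.
apply: smallest_sub; last first.
  move=> x xG; exists [fset x]%fset; first by move=> y /= /fset1P ->.
  by apply: sub_gen_smallest; rewrite /= in_fset1.
split.
- by exists fset0 => //; have [] := generated_subalgebraP [set` (fset0 : {fset A})].
- by exists fset0 => //; have [] := generated_subalgebraP [set` (fset0 : {fset A})].
- move=> x y Sx Sy; apply: (SU x y Order.meet) => // F.
  by have [_ _ FI _ _] := generated_subalgebraP F; exact: FI.
- move=> x y Sx Sy; apply: (SU x y Order.join) => // F.
  by have [_ _ _ FU _] := generated_subalgebraP F; exact: FU.
- move=> x [F FG xF]; exists F => //.
  by have [_ _ _ _ FC] := generated_subalgebraP [set` F]; exact: FC.
Qed.

End Subalgebra.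

(** * Ultrafilters of a Boolean algebra *)

Section Ultrafilter.
Local Open Scope order_scope.
Variables (disp : Order.disp_t) (A : ctbDistrLatticeType disp).
Implicit Types (a b : A) (U V : set A).

(** If [U] omits [~` a], then [U] together with [a] generates a proper filter,
    which is [U] by maximality. *)
Lemma ultrafilter_decides U a : ultrafilter U -> U a \/ U (~` a).
Proof.
move=> [[U1 U0 UI Uup] Umax]; have [UNa|UNa] := pselect (U (~` a)); first by right.
left; pose V := [set b | exists2 u, U u & u `&` a <= b].
have <- : V = U; last by exists \top => //; exact: leIr.
apply: Umax; last by move=> u Uu; exists u => //; exact: leIl.
split.
- by exists \top => //; exact: lex1.
- move=> [u Uu]; rewrite lex0 disj_leC => uNa.
  exact/UNa/(Uup _ _ Uu).
- move=> x y [u Uu ux] [v Uv vy]; exists (u `&` v); first exact: UI.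
  rewrite lexI (le_trans _ ux) ?(le_trans _ vy) //; apply: leI2 => //.
    exact: leIr.
  exact: leIl.
- by move=> x y [u Uu ux] xy; exists u => //; exact: le_trans xy.
Qed.

Lemma proper_filter_sub_ultrafilter U :
  proper_filter U -> exists2 V, ultrafilter V & (U `<=` V)%classic.
Proof.
move=> Upf; have [U1 U0 UI Uup] := Upf.
(* Zorn's lemma is applied to the sets whose union with [U] is a proper filter,
   so that the empty chain is bounded by the empty set. *)
have [|V [Vpf Vmax]] := @Zorn_bigcup A [set V | proper_filter (U `|` V)%classic].
  move=> C Cpf Ctot.
  (* Any two elements of the union lie in a common proper filter of the chain. *)
  have common x y : (U `|` \bigcup_(X in C) X)%classic x ->
      (U `|` \bigcup_(X in C) X)%classic y ->
      exists W, [/\ proper_filter W,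
        (W `<=` U `|` \bigcup_(X in C) X)%classic, W x & W y].
    have CW X : C X -> (U `|` X `<=` U `|` \bigcup_(X in C) X)%classic.
      by move=> CX; apply: setUS; exact: bigcup_sup.
    move=> [Ux|[X CX Xx]] [Uy|[Y CY Yy]].
    - by exists U; split => //; exact: subsetUl.
    - by exists (U `|` Y)%classic; split; [exact: Cpf|exact: CW|left|right].
    - by exists (U `|` X)%classic; split; [exact: Cpf|exact: CW|right|left].
    - have [XY|YX] := Ctot X Y CX CY.
        by exists (U `|` Y)%classic; split; [exact: Cpf|exact: CW|right; exact: XY|right].
      by exists (U `|` X)%classic; split; [exact: Cpf|exact: CW|right|right; exact: YX].
  split.
  - by left.
  - by move=> W0; have [W [[_ nW _ _] _ Wx _]] := common _ _ W0 W0.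
  - move=> x y Wx Wy; have [W [[_ _ WI _] sW {}Wx {}Wy]] := common _ _ Wx Wy.
    exact/sW/WI.
  - move=> x y Wx xy; have [W [[_ _ _ Wup] sW {}Wx _]] := common _ _ Wx Wx.
    exact/sW/(Wup x).
exists (U `|` V)%classic; last exact: subsetUl.
split => // W Wpf UVW; apply/seteqP; split => // x Wx; apply: contrapT => nx.
have UW : (U `<=` W)%classic by move=> y Uy; apply: UVW; left.
apply: (Vmax W); last by rewrite /= (proj2 (setUidPr U W) UW).
by split=> [y Vy|WV]; [apply: UVW; right|apply: nx; right; exact: WV].
Qed.

End Ultrafilter.

(** * Covers of the Stone space by atoms *)

Section StoneSpace.
Local Open Scope order_scope.
Variables (disp : Order.disp_t) (A : ctbDistrLatticeType disp).
Implicit Types (a b : A) (p : stone_space A) (F G : {fset A}).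

Lemma open_stone_basic a : open (stone_basic a).
Proof.
exists [set stone_basic a]%classic; last by rewrite bigcup_set1.
by move=> _ ->; exists a.
Qed.

Lemma open_stone_basicP (X : set (stone_space A)) p :
  open X -> X p -> exists2 a, stone_set p a & (stone_basic a `<=` X)%classic.
Proof.
move=> [D' D'b <-] [B D'B Bp]; have [a _ Ba] := D'b _ D'B.
exists a; first by move: Bp; rewrite -Ba.
by rewrite Ba; exact: bigcup_sup.
Qed.

Lemma stone_basicS a b : a <= b -> (stone_basic a `<=` stone_basic b)%classic.
Proof. by move=> ab [U [[U1 U0 UI Uup] Umax]] /= Ua; exact: Uup ab. Qed.

Lemma stone_basicC a : stone_basic (~` a) = (~` stone_basic a)%classic.
Proof.
apply/seteqP; split=> [[U UP] /=|[U UP] /= nUa]; have [[U1 U0 UI Uup] Umax] := UP.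
  by move=> UNa Ua; apply: U0; rewrite -(meetxC a); exact: UI.
by have [|] := ultrafilter_decides a UP.
Qed.

Lemma closed_stone_basic a : closed (stone_basic a).
Proof. by rewrite -openC -stone_basicC; exact: open_stone_basic. Qed.

Definition atom_cover F : set (set (stone_space A)) :=
  (@stone_basic _ A @` Atom [set` F])%classic.

Lemma bigcup_atom_cover F : (\bigcup_(X in atom_cover F) X)%classic = [set: stone_space A]%classic.
Proof.
apply/seteqP; split => // p _.
have pP := stone_setP p.
have [a aF pa] := @filter_atom _ _ F _ (proj1 pP) (fun f _ => ultrafilter_decides f pP).
by exists (stone_basic a) => //; exists a.
Qed.

Lemma FCC_atom_cover F : finite_set (Atom [set` F]) -> FCC (atom_cover F).
Proof.
move=> Ffin; split; [exact: finite_image| |exact: bigcup_atom_cover].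
by move=> _ [a _ <-]; exact: closed_stone_basic.
Qed.

Lemma refines_atom_cover F G :
  ([set` F] `<=` [set` G])%classic -> refines (atom_cover G) (atom_cover F).
Proof.
move=> FG _ [b bG <-]; have [a aF ba] := atom_le_atom FG bG.
by exists (stone_basic a); [exists a|exact: stone_basicS].
Qed.

Section Subordinate.
Variables (Gamma : set A) (Us : set (set (stone_space A))).

Definition cut_subordinate F a := forall b, Atom [set` F] b -> b <= a ->
  exists2 X, Us X & (stone_basic b `<=` X)%classic.

(** Requiring [a] to lie in the subalgebra generated by [F] makes the atoms over
    [F] decide [a]; this is what lets [F] be enlarged and two witnesses be
    merged. *)
Definition subordinate a := exists F,
  [/\ ([set` F] `<=` Gamma)%classic, generated_subalgebra [set` F] a & cut_subordinate F a].

(** An atom over [G] below [a] lies below an atom over [F]; the latter decides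
    [a], hence is below [a] too. *)
Lemma cut_subordinateS F G a : ([set` F] `<=` [set` G])%classic ->
  generated_subalgebra [set` F] a -> cut_subordinate F a -> cut_subordinate G a.
Proof.
move=> FG aF Fa b bG ba; have [e eF be] := atom_le_atom FG bG.
have [ea|eNa] := atom_decides eF aF.
  by have [X UX eX] := Fa _ eF ea; exists X => //; exact: subset_trans (stone_basicS be) eX.
by have [_ b0 _] := bG; case: b0; exact: le_compl_self ba (le_trans be eNa).
Qed.

Lemma subordinate_bot : subordinate \bot.
Proof.
exists fset0; split => //.
  by have [] := generated_subalgebraP [set` (fset0 : {fset A})].
by move=> b [_ b0 _]; rewrite lex0 => /eqP.
Qed.

Lemma subordinate_join a b : subordinate a -> subordinate b -> subordinate (a `|` b).
Proof.
move=> [F [FG aF Fa]] [G [GG bG Gb]]; pose H := (F `|` G)%fset.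
have FH : ([set` F] `<=` [set` H])%classic by move=> x /= xF; rewrite in_fsetU xF.
have GH : ([set` G] `<=` [set` H])%classic by move=> x /= xG; rewrite in_fsetU xG orbT.
have aH := generated_subalgebraS FH aF; have bH := generated_subalgebraS GH bG.
have [_ _ _ HU _] := generated_subalgebraP [set` H].
exists H; split; first by move=> x /= /fsetUP[]; [exact: FG|exact: GG].
  exact: HU.
move=> c cH cab.
have [ca|cNa] := atom_decides cH aH; first exact: cut_subordinateS FH aF Fa _ cH ca.
have [cb|cNb] := atom_decides cH bH; first exact: cut_subordinateS GH bG Gb _ cH cb.
have [_ c0 _] := cH; case: c0; apply: le_compl_self cab _.
by rewrite complU lexI cNa cNb.
Qed.

Hypothesis Gamma_generates : generated_subalgebra Gamma = setT.

Lemma subordinate_le a b : a <= b -> subordinate b -> subordinate a.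
Proof.
move=> ab [F [FG bF Fb]].
have [|G GG aG] := @generated_subalgebra_finite _ _ Gamma a; first by rewrite Gamma_generates.
exists (F `|` G)%fset; split.
- by move=> x /= /fsetUP[]; [exact: FG|exact: GG].
- by apply: generated_subalgebraS aG => x /= xG; rewrite in_fsetU xG orbT.
- move=> c cH ca; apply: (cut_subordinateS _ bF Fb) cH (le_trans ca ab).
  by move=> x /= xF; rewrite in_fsetU xF.
Qed.

Lemma subordinate_basic a X : Us X -> (stone_basic a `<=` X)%classic -> subordinate a.
Proof.
move=> UX aX; have [|F FG aF] := @generated_subalgebra_finite _ _ Gamma a.
  by rewrite Gamma_generates.
exists F; split => // b _ ba; exists X => //.
exact: subset_trans (stone_basicS ba) aX.
Qed.

(** If [\top] were not subordinate, the complements of subordinate elements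
    would form a proper filter, and an ultrafilter extending it would be a
    point not covered by [Us]. *)
Lemma subordinate_top : open_cover Us -> subordinate \top.
Proof.
move=> [Uopen Ucover]; apply: contrapT => nT.
have [|p pP Vp] := @proper_filter_sub_ultrafilter _ A [set a | subordinate (~` a)%O]%classic.
  split => /=.
  - by rewrite compl1; exact: subordinate_bot.
  - by rewrite compl0.
  - by move=> a b Ia Ib; rewrite complI; exact: subordinate_join.
  - by move=> a b Ia ab; apply: subordinate_le Ia; rewrite leC.
have : (\bigcup_(X in Us) X)%classic (StoneSpace pP) by rewrite Ucover.
move=> [X UX Xp]; have [a pa aX] := open_stone_basicP (Uopen _ UX) Xp.
have pNa : p (~` a) by apply: Vp; rewrite /= complK; exact: subordinate_basic UX aX.
have [[_ p0 pI _] _] := pP; apply: p0; rewrite -(meetxC a); exact: pI.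
Qed.

End Subordinate.

Lemma atom_covers_cofinal (Gamma : set A) :
  generated_subalgebra Gamma = setT ->
  topologically_cofinal [set atom_cover F | F in [set F | ([set` F] `<=` Gamma)%classic]]%classic.
Proof.
move=> GammaT Us UsP; have [F [FG _ FT]] := subordinate_top GammaT UsP.
exists (atom_cover F); first by exists F.
by move=> _ [a aF <-]; exact: FT aF (lex1 a).
Qed.

End StoneSpace.

(** * Cardinality bounds and the dimension estimate *)

Lemma card_le_real_le (R : realType) (T : Type) (S : set T) (n : nat) (x : R) :
  (S #<= `I_n)%card -> n%:R <= x -> card_le_real S x.
Proof.
move=> Sn nx; have [m Sm] : finite_set S by apply/finite_set_leP; exists n.
exists m => //; apply: le_trans nx.
by rewrite ler_nat -card_le_II -(card_le_eql Sm).
Qed.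

Lemma card_le_real_image (R : realType) (T U : Type) (f : T -> U) (S : set T) (x y : R) :
  card_le_real S x -> x <= y -> card_le_real (f @` S) y.
Proof.
move=> [n Sn nx] xy; apply: (@card_le_real_le _ _ _ n); last exact: le_trans xy.
by rewrite -(card_le_eqr Sn) card_image_le.
Qed.

Lemma card_le_real_finite (R : realType) (T : Type) (S : set T) (x : R) :
  card_le_real S x -> finite_set S.
Proof. by move=> [n Sn _]; exists n. Qed.

Lemma leq_card_bigfcup (T : choiceType) (I : finType) (F : I -> {fset T}) :
  (#|` (\bigcup_(i <- enum I) F i)%fset| <= \sum_(i : I) #|` F i|)%N.
Proof.
rewrite -big_enum; apply: (big_rec2 (fun (G : {fset T}) n => #|` G| <= n)%N) => [|i n G _ Gn].
  by rewrite cardfs0.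
apply: leq_trans (leq_card_fsetU _ _) _.
by rewrite leq_add2l.
Qed.

Theorem theorem4p1 (R : realType) (d : nat) (M : R) (disp : Order.disp_t)
    (A : ctbDistrLatticeType disp) (Gamma : set A) :
  0 <= M ->
  generated_subalgebra Gamma = setT ->
  (forall F : {fset A}, F != fset0 -> [set` F] `<=` Gamma ->
     card_le_real (Atom [set` F]) (M * (#|` F|)%:R ^+ d)) ->
  free_dim_le (stone_space A) R d.
Proof.
move=> M0 GammaT bound.
have M1 : 0 < M + 1 by apply: ltr_wpDl.
have bound1 (F : {fset A}) : [set` F] `<=` Gamma ->
    card_le_real (Atom [set` F]) ((M + 1) * (#|` F|.+1)%:R ^+ d).
  move=> FG; have [->|F0] := eqVneq F fset0.
    apply: (@card_le_real_le _ _ _ 1%N).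
      by rewrite -(card_le_eqr (@card_set1 _ (\top%O : A))); apply/subset_card_le/atom_set0.
    by rewrite cardfs0 expr1n mulr1 lerDr.
  have [n Fn nM] := bound F F0 FG; exists n => //; apply: le_trans nM _.
  apply: ler_pM => //; first exact: exprn_ge0.
    by rewrite lerDl.
  by rewrite lerXn2r ?nnegrE // ler_nat.
(* Different finite sets may give the same cover, while [chi] depends on the
   cover only: one generating set [gen C] is chosen for each cover [C]. *)
pose gen C := xget fset0 [set F : {fset A} | [set` F] `<=` Gamma /\ atom_cover F = C].
pose CC := [set atom_cover F | F in [set F : {fset A} | [set` F] `<=` Gamma]].
have genP C : CC C -> [set` gen C] `<=` Gamma /\ atom_cover (gen C) = C.
  by move=> [F FG FC]; apply: (@xgetPex _ fset0 [set F | [set` F] `<=` Gamma /\ _]); exists F.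
exists CC, (M + 1), (fun C => #|` gen C|.+1); split => //.
- by move=> _ [F FG <-]; apply/FCC_atom_cover/card_le_real_finite/bound1.
- exact: atom_covers_cofinal.
move=> k Cs k_gt0 CsP; pose F := (\bigcup_(i <- enum 'I_k) gen (Cs i))%fset.
have FG : [set` F] `<=` Gamma.
  move=> x /= /bigfcupP[i _ xi].
  exact: (proj1 (genP _ (CsP i))).
exists (atom_cover F); split.
- exact/FCC_atom_cover/card_le_real_finite/bound1.
- move=> i; rewrite -(proj2 (genP _ (CsP i))); apply: refines_atom_cover => x /= xi.
  by apply/bigfcupP; exists i => //; rewrite mem_enum.
- apply: card_le_real_image (bound1 F FG) _.
  rewrite ler_pM2l // lerXn2r ?nnegrE // ler_nat.
  under eq_bigr do rewrite -addn1.
  rewrite big_split /= sum1_card card_ord -[ltnLHS]addn0.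
  by rewrite -addn1 -addnA leq_add // leq_card_bigfcup.
Qed.
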